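(* Let $G=(V,K)$ be a connected, locally finite graph with infinite vertex set and maximal degree $B=\sup_{i\in V}B_i<\infty$. Then for every $\beta>0$ there exist neighborhoods $U^1_\epsilon,U^0_\epsilon,U^{-1}_\epsilon$ ($\epsilon>0$) such that for every $\alpha\in\bigcup_{i\in E}U^i_\epsilon$ the specification $\gamma^{sc}_{\beta,\alpha}$ of the soft-core Widom-Rowlinson model on $G$ satisfies Dobrushin's condition.
   Context: $E=\{-1,0,1\}$, $\mathcal M_1(E)$ is the set of probability measures on $E$, $d_{TV}(\mu,\nu)=\frac12\sum_{a\in E}|\mu(a)-\nu(a)|$, and for $\epsilon>0$, $i\in E$, $U^i_\epsilon=\{\alpha\in\mathcal M_1(E): d_{TV}(\alpha,\delta_i)<\epsilon\}$. $B_i$ is the degree of $i\in V$; $\Omega=E^V$. The soft-core Widom-Rowlinson specification with repulsion $\beta$ and a priori measure $\alpha$ is, for finite $\Lambda\subset V$, $\omega\in E^\Lambda$, $\eta\in E^{V\setminus\Lambda}$, $$\gamma^{sc}_{\Lambda,\beta,\alpha}(\omega|\eta)=\frac1{Z_\eta}\exp\Big(-\beta\sum_{\{i,j\}\in K,\ \{i,j\}\cap\Lambda\neq\emptyset}\mathbf 1(\xi_i\xi_j=-1)\Big)\prod_{i\in\Lambda}\alpha(\omega_i),\qquad \xi=\omega_\Lambda\eta_{V\setminus\Lambda},$$ with $Z_\eta$ the normalization. For a specification $\gamma$ let $\gamma^0_i(\cdot|\eta)$ be the law on $E$ of the spin at $i$ under $\gamma_{\{i\}}(\cdot|\eta_{V\setminus\{i\}})$,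 and $$C_{ij}(\gamma)=\sup\{d_{TV}(\gamma^0_i(\cdot|\eta),\gamma_i^0(\cdot|\zeta)):\ \eta,\zeta\in\Omega,\ \eta_{V\setminus\{j\}}=\zeta_{V\setminus\{j\}}\}.$$ The Dobrushin constant is $c(\gamma)=\sup_{i\in V}\sum_{j\in V}C_{ij}(\gamma)$. $\gamma$ satisfies Dobrushin's condition if $c(\gamma)<1$ and $\gamma$ is quasilocal, i.e. $\gamma_\Lambda(f|\cdot)$ is a uniform limit of local functions (functions depending on finitely many coordinates) whenever $f$ is, for every finite $\Lambda$. *)

(* Defs.v *)
From HB Require Import structures.
From mathcomp Require Import all_boot all_order all_algebra finmap.
From mathcomp Require Import all_classical all_reals all_analysis.

Set Implicit Arguments.
Unset Strict Implicit.
Unset Printing Implicit Defensive.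

Import Order.TTheory GRing.Theory Num.Theory.
Import numFieldNormedType.Exports.

Local Open Scope classical_set_scope.
Local Open Scope ring_scope.

Section Graphs.
Variable V : choiceType.

Record graph := Graph {
  adj :> rel V;
  adj_sym : symmetric adj;
  adj_irrefl : irreflexive adj }.

Definition neighbours (G : graph) (i : V) : set V := [set j | G i j].

Definition locally_finite (G : graph) := forall i, finite_set (neighbours G i).

(* [fset_set] is junk (empty) on infinite sets: meaningful for locally finite
   graphs only. *)
Definition degree (G : graph) (i : V) : nat := #|` fset_set (neighbours G i)|%fset.

Definition max_degree (R : realType) (G : graph) : \bar R :=
  ereal_sup (range (fun i => (degree G i)%:R%:E)).

Definition connected_graph (G : graph) :=
  forall i j, exists p : seq V, path G i p /\ last i p = j.

Definition edges (G : graph) : set {fset V} :=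
  [set k | exists i j, G i j /\ k = [fset i; j]%fset].

Definition edges_touching (G : graph) (L : {fset V}) : set {fset V} :=
  [set k | edges G k /\ exists2 i, i \in k & i \in L].

Lemma finite_edges_touching (G : graph) (L : {fset V}) :
  locally_finite G -> finite_set (edges_touching G L).
Proof.
move=> Gfin; pose A := \bigcup_(i in [set` L])
  ((fun j => [fset i; j]%fset) @` neighbours G i).
apply: (@sub_finite_set _ _ A).
  move=> k [[i [j [Gij ->]]] [x]]; rewrite !inE => /orP[] /eqP -> xL.
    by exists i => //; exists j.
  exists j => //; exists i; last by rewrite fsetUC.
  by rewrite /neighbours /= adj_sym.
by apply: bigcup_finite => // i _; apply: finite_image.
Qed.

End Graphs.

(* The spin space {-1, 0, 1}, as a finite subtype of int. *)
Definition spin : finType := seq_sub [:: -1; 0; 1 : int].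
Definition spin_val (a : spin) : int := ssval a.

Section Distributions.
Variable R : realType.

Record fdist (T : finType) := FDist {
  mass :> T -> R;
  mass_ge0 : forall a, 0 <= mass a;
  mass_sum1 : \sum_a mass a = 1 }.

Definition d_TV (T : finType) (mu nu : fdist T) : R :=
  2^-1 * \sum_a `|mu a - nu a|.

Section Dirac.
Variables (T : finType) (i : T).
Definition dirac_mass (a : T) : R := (a == i)%:R.
Lemma dirac_mass_ge0 a : 0 <= dirac_mass a.
Proof. exact: ler0n. Qed.
Lemma dirac_mass_sum1 : \sum_a dirac_mass a = 1.
Proof.
rewrite (bigD1 i) //= /dirac_mass eqxx big1 ?addr0 // => a.
by move=> /negbTE ->.
Qed.
Definition fdirac : fdist T := FDist dirac_mass_ge0 dirac_mass_sum1.
End Dirac.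

Section Image.
Variables (T U : finType) (f : T -> U) (mu : fdist T).
Definition image_mass (b : U) : R := \sum_(a | f a == b) mu a.
Lemma image_mass_ge0 b : 0 <= image_mass b.
Proof. by apply: sumr_ge0 => a _; apply: mass_ge0. Qed.
Lemma image_mass_sum1 : \sum_b image_mass b = 1.
Proof.
by rewrite -(mass_sum1 mu) (partition_big f xpredT).
Qed.
Definition fimage : fdist U := FDist image_mass_ge0 image_mass_sum1.
End Image.

Definition tv_ball (T : finType) (i : T) (eps : R) : set (fdist T) :=
  [set alpha | d_TV alpha (fdirac i) < eps].

End Distributions.

Section Specifications.
Variables (R : realType) (V : choiceType).

Definition config := V -> spin.

Definition agree_on (D : set V) (eta zeta : config) :=
  forall i, D i -> eta i = zeta i.

(* The configuration omega_L eta_(V \ L). *)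
Definition glue (L : {fset V}) (omega : {ffun L -> spin}) (eta : config) :
  config := fun i => oapp omega (eta i) (insub i).

Definition local (f : config -> R) :=
  exists L : {fset V}, forall eta zeta, agree_on [set` L] eta zeta ->
    f eta = f zeta.

Definition quasilocal (f : config -> R) :=
  exists F : nat -> config -> R,
    (forall n, local (F n)) /\ {uniform, F @ \oo --> f}.

(* These events generate the product sigma-algebra on spin ^ V. *)
Definition local_events : set (set config) :=
  [set A | exists L : {fset V}, forall eta zeta,
    agree_on [set` L] eta zeta -> A eta -> A zeta].

(* A finite-volume law is a mass function on spin ^ L; the boundary condition
   is given as a configuration on V of which only the values off L matter. *)
Definition kernel_family :=
  forall L : {fset V}, config -> fdist R {ffun L -> spin}.

(* gamma_L(f | eta) *)
Definition expect (gamma : kernel_family) (L : {fset V}) (f : config -> R) :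
  config -> R := fun eta => \sum_omega gamma L eta omega * f (glue omega eta).

Record specification := Specification {
  spec_kernel : kernel_family;
  spec_proper : forall (L : {fset V}) eta zeta, agree_on (~` [set` L]) eta zeta ->
    spec_kernel L eta =1 spec_kernel L zeta;
  spec_measurable : forall (L : {fset V}) (omega : {ffun L -> spin})
      (B : set R), measurable B ->
    <<s local_events >> ((fun eta => spec_kernel L eta omega) @^-1` B);
  spec_consistent : forall (D L : {fset V}) (f : config -> R),
    (D `<=` L)%fset ->
    expect spec_kernel L (expect spec_kernel D f) = expect spec_kernel L f }.

(* gamma^0_i(. | eta) *)
Definition single_site (gamma : specification) (i : V) (eta : config) :
  fdist R spin :=
  fimage (fun omega : {ffun [fset i]%fset -> spin} => omega [` fset11 i]%fset)
    (spec_kernel gamma [fset i]%fset eta).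

Definition dobrushin_coeff (gamma : specification) (i j : V) : \bar R :=
  ereal_sup [set x | exists eta zeta, agree_on (~` [set j]) eta zeta /\
    x = (d_TV (single_site gamma i eta) (single_site gamma i zeta))%:E].

Definition dobrushin_const (gamma : specification) : \bar R :=
  ereal_sup (range (fun i => \esum_(j in [set: V]) dobrushin_coeff gamma i j)).

Definition quasilocal_spec (gamma : specification) :=
  forall (L : {fset V}) (f : config -> R), quasilocal f ->
    quasilocal (expect (spec_kernel gamma) L f).

Definition dobrushin_condition (gamma : specification) :=
  (dobrushin_const gamma < 1%:E)%E /\ quasilocal_spec gamma.

Lemma glue_in (L : {fset V}) (omega : {ffun L -> spin}) eta (x : L) :
  glue omega eta (val x) = omega x.
Proof. by rewrite /glue valK. Qed.

Lemma glue_out (L : {fset V}) (omega : {ffun L -> spin}) eta i :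
  i \notin L -> glue omega eta i = eta i.
Proof. by move=> iL; rewrite /glue insubN. Qed.

Lemma glue_proper (L : {fset V}) (omega : {ffun L -> spin}) eta zeta :
  agree_on (~` [set` L]) eta zeta -> glue omega eta = glue omega zeta.
Proof.
move=> h; apply/funext => i; rewrite /glue; case: insubP => //= iL.
exact/h/negP.
Qed.

End Specifications.

Section WidomRowlinson.
Variables (R : realType) (V : choiceType) (G : graph V).

(* For k = {i, j} an edge, this is xi_i xi_j = -1. *)
Definition repels (xi : config V) (k : {fset V}) : bool :=
  \prod_(i <- k) spin_val (xi i) == -1.

Definition wr_energy (L : {fset V}) (xi : config V) : R :=
  \sum_(k \in edges_touching G L) ((repels xi k)%:R : R).

Variables (beta : R) (alpha : fdist R spin).

Definition wr_weight (L : {fset V}) (eta : config V)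
    (omega : {ffun L -> spin}) : R :=
  expR (- beta * wr_energy L (glue omega eta)) * \prod_(i : L) alpha (omega i).

Definition wr_partition (L : {fset V}) (eta : config V) : R :=
  \sum_(omega : {ffun L -> spin}) wr_weight eta omega.

Definition wr_mass (L : {fset V}) (eta : config V) (omega : {ffun L -> spin}) :
  R := wr_weight eta omega / wr_partition L eta.

Lemma wr_weight_ge0 (L : {fset V}) eta (omega : {ffun L -> spin}) : 0 <= wr_weight eta omega.
Proof.
apply: mulr_ge0; first exact: expR_ge0.
by apply: prodr_ge0 => i _; apply: mass_ge0.
Qed.

Lemma wr_partition_gt0 L eta : 0 < wr_partition L eta.
Proof.
have [a a0] : exists a, 0 < alpha a.
  apply/not_existsP => h; have := mass_sum1 alpha.
  rewrite big1 => [/esym/eqP|a _]; first by rewrite oner_eq0.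
  by apply/eqP; move/negP: (h a); rewrite lt0r mass_ge0 andbT negbK.
rewrite /wr_partition (bigD1 [ffun=> a]) //=; apply: ltr_wpDr.
  by apply: sumr_ge0 => omega _; apply: wr_weight_ge0.
apply: mulr_gt0; first exact: expR_gt0.
by apply: prodr_gt0 => i _; rewrite ffunE.
Qed.

Lemma wr_mass_ge0 (L : {fset V}) eta (omega : {ffun L -> spin}) : 0 <= wr_mass eta omega.
Proof. by rewrite divr_ge0 ?wr_weight_ge0 // ltW // wr_partition_gt0. Qed.

Lemma wr_mass_sum1 (L : {fset V}) eta :
  \sum_(omega : {ffun L -> spin}) wr_mass eta omega = 1.
Proof. by rewrite -mulr_suml divff // gt_eqF // wr_partition_gt0. Qed.

Definition wr_kernel : kernel_family R V :=
  fun L eta => FDist (@wr_mass_ge0 L eta) (wr_mass_sum1 L eta).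

Lemma wr_kernel_proper (L : {fset V}) eta zeta : agree_on (~` [set` L]) eta zeta ->
  wr_kernel L eta =1 wr_kernel L zeta.
Proof.
move=> h omega /=; rewrite /wr_mass /wr_partition /wr_weight (glue_proper _ h).
by congr (_ / _); apply: eq_bigr => w _; rewrite (glue_proper _ h).
Qed.

Hypothesis Gfin : locally_finite G.

Lemma repels_eq (xi xi' : config V) (k : {fset V}) :
  {in k, xi =1 xi'} -> repels xi k = repels xi' k.
Proof.
by move=> h; rewrite /repels; congr (_ == _); apply: eq_big_seq => i /h ->.
Qed.

Lemma wr_kernel_measurable (L : {fset V}) (omega : {ffun L -> spin})
    (B : set R) : measurable B ->
  <<s @local_events V >> ((fun eta => wr_kernel L eta omega) @^-1` B).
Proof.
move=> mB; apply: sub_sigma_algebra.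
exists (\bigcup_(k <- fset_set (edges_touching G L)) k)%fset.
move=> eta zeta h /= Beta.
suff E (w : {ffun L -> spin}) : wr_weight eta w = wr_weight zeta w.
  move: Beta; congr (B _); rewrite /wr_mass /wr_partition E.
  by congr (_ / _); apply: eq_bigr => w _; rewrite E.
rewrite /wr_weight; congr (expR (_ * _) * _); apply: eq_fsbigr => k kG.
rewrite (@repels_eq _ (glue w zeta)) // => i ik.
rewrite /glue; case: insubP => //= iL; apply: h.
apply/bigfcupP; exists k => //.
by rewrite andbT in_fset_set //; apply: finite_edges_touching.
Qed.

Let weight (L : {fset V}) (xi : config V) : R :=
  expR (- beta * wr_energy L xi) * \prod_(i <- L) alpha (xi i).

Let wr_weightE (L : {fset V}) eta (omega : {ffun L -> spin}) :
  wr_weight eta omega = weight L (glue omega eta).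
Proof.
rewrite /wr_weight /weight big_seq_fsetE /=; congr (_ * _).
by apply: eq_bigr => i _; rewrite glue_in.
Qed.

Let weight_split (D L : {fset V}) : (D `<=` L)%fset ->
  exists r : config V -> R,
    (forall xi, weight L xi = weight D xi * r xi) /\
    (forall xi xi', agree_on (~` [set` D]) xi xi' -> r xi = r xi').
Proof.
move=> DL; pose S := edges_touching G L `\` edges_touching G D.
exists (fun xi => expR (- beta * \sum_(k \in S) ((repels xi k)%:R : R)) *
                  \prod_(i <- (L `\` D)%fset) alpha (xi i)); split.
  move=> xi; have subK : edges_touching G D `<=` edges_touching G L.
    by move=> k [kG [i ik iD]]; split=> //; exists i => //; apply: (fsubsetP DL).
  rewrite /weight [in LHS]/wr_energy.
  rewrite (fsbigID (edges_touching G D)) /=; last first.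
    exact: finite_edges_touching.
  rewrite (setIidr subK) -/(wr_energy _ _) mulrDr expRD.
  rewrite (big_fsetID _ (mem D)) /=.
  have -> : [fset x in L | x \in D]%fset = D.
    apply/fsetP => x; rewrite !inE /=.
    by case: (boolP (x \in D)) => [/(fsubsetP DL) -> //|]; rewrite ?andbF.
  have -> : [fset x in L | x \notin D]%fset = (L `\` D)%fset.
    by apply/fsetP => x; rewrite !inE /= andbC.
  by rewrite mulrACA.
move=> xi xi' h; congr (expR (_ * _) * _).
  apply: eq_fsbigr => k; rewrite inE => -[[kG _] nkD].
  rewrite (@repels_eq _ xi') // => i ik; apply: h => iD; apply: nkD.
  by split=> //; exists i.
by apply: eq_big_seq => i; rewrite inE => /andP[iD _]; rewrite h //; apply/negP.
Qed.

Lemma wr_kernel_consistent (D L : {fset V}) (f : config V -> R) :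
  (D `<=` L)%fset ->
  expect wr_kernel L (expect wr_kernel D f) = expect wr_kernel L f.
Proof.
move=> DL; have [r [wr rD]] := weight_split DL.
apply/funext => eta; rewrite /expect /= /wr_mass.
under eq_bigr do rewrite mulrAC.
under [RHS]eq_bigr do rewrite mulrAC.
rewrite -!mulr_suml; congr (_ / _).
pose Z (xi : config V) := wr_partition D xi.
pose swp (p : {ffun L -> spin} * {ffun D -> spin}) :=
  ([ffun x : L => glue p.2 (glue p.1 eta) (val x)],
   [ffun y : D => glue p.1 eta (val y)]).
have glue1 p : glue (swp p).1 eta = glue p.2 (glue p.1 eta).
  apply/funext => i; have [iL|iL] := boolP (i \in L).
    by rewrite (glue_in _ eta [` iL]%fset) ffunE.
  have iD : i \notin D by apply: contra iL; apply: (fsubsetP DL).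
  by rewrite !glue_out.
have glue2 p : glue (swp p).2 (glue (swp p).1 eta) = glue p.1 eta.
  rewrite glue1; apply/funext => i; have [iD|iD] := boolP (i \in D).
    by rewrite (glue_in _ _ [` iD]%fset) ffunE.
  by rewrite glue_out // glue_out.
have swpK : involutive swp.
  move=> [w w']; rewrite {1}/swp; congr (_, _); apply/ffunP => x; rewrite ffunE.
    by rewrite glue2 glue_in.
  by rewrite glue1 glue_in.
have offD (w' : {ffun D -> spin}) xi : agree_on (~` [set` D]) (glue w' xi) xi.
  by move=> i /negP iD; rewrite glue_out.
have ZD (w' : {ffun D -> spin}) xi : Z (glue w' xi) = Z xi.
  apply: eq_bigr => w _; rewrite !wr_weightE; congr (weight _ _).
  by apply: glue_proper; apply: offD.
transitivity (\sum_(p : {ffun L -> spin} * {ffun D -> spin})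
   weight L (glue p.1 eta) * (weight D (glue p.2 (glue p.1 eta)) /
   Z (glue p.1 eta) * f (glue p.2 (glue p.1 eta)))).
  rewrite -(pair_bigA _ (fun w w' => weight L (glue w eta) *
    (weight D (glue w' (glue w eta)) / Z (glue w eta) *
     f (glue w' (glue w eta))))) /=.
  apply: eq_bigr => w _; rewrite wr_weightE mulr_sumr.
  by apply: eq_bigr => w' _; rewrite wr_weightE.
rewrite (reindex_inj (inv_inj swpK)) /=.
under eq_bigr => p _ do rewrite glue2 glue1 ZD.
rewrite -(pair_bigA _ (fun w w' => weight L (glue w' (glue w eta)) *
  (weight D (glue w eta) / Z (glue w eta) * f (glue w eta)))) /=.
apply: eq_bigr => w _; rewrite -mulr_suml wr_weightE.
have -> : \sum_(w' : {ffun D -> spin}) weight L (glue w' (glue w eta)) =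
          Z (glue w eta) * r (glue w eta).
  rewrite mulr_suml; apply: eq_bigr => w' _.
  by rewrite wr wr_weightE (rD _ _ (offD _ _)).
have Z0 : Z (glue w eta) != 0 by rewrite gt_eqF // wr_partition_gt0.
rewrite (wr (glue w eta)) mulrA; congr (_ * _).
by rewrite mulrACA (mulrC (r _)) mulrACA divff // mul1r.
Qed.

Definition widom_rowlinson : specification R V :=
  Specification wr_kernel_proper wr_kernel_measurable wr_kernel_consistent.

End WidomRowlinson.

(* Main.v *)
From Pilot Require Import Defs.
From mathcomp Require Import all_boot all_order all_algebra finmap.
From mathcomp Require Import all_classical all_reals all_analysis.
From mathcomp Require Import ring lra.
(* Gluing of configurations takes precedence over gluing of functions. *)
Import Pilot.Defs.

Import Order.TTheory GRing.Theory Num.Theory.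
Import numFieldNormedType.Exports.

Local Open Scope classical_set_scope.
Local Open Scope ring_scope.

(** If the a priori measure [alpha] is close to a Dirac mass at a spin [s],
    then so is every single-site conditional law, uniformly in the boundary
    condition.  Indeed the energy seen by one site is at most the number of
    its neighbours, hence at most the maximal degree [N], so the Boltzmann
    factor lies between [m = exp (- beta * N)] and 1.  A spin [a <> s] thus has
    weight at most [alpha a], while the partition function is at least
    [m * alpha s]; summing over [a <> s] and using that
    [d_TV mu delta_s = 1 - mu s], the conditional law is at distance at most
    [d_TV alpha delta_s / (m * alpha s)] from [delta_s]
    ([single_site_dirac_le]).

    By the triangle inequality through [delta_s], every Dobrushin coefficient
    is at most twice this bound, and it vanishes between non-neighbours since
    the interaction has range one ([dobrushin_coeff_wr_nonadj]).  A row of the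
    Dobrushin matrix therefore has at most [N] nonzero entries, each as small
    as desired when [alpha] is close enough to [delta_s], so the row sums can
    be kept below 1 ([dobrushin_const_le]).  The same radius serves for all
    three spins, because the argument never looks at which spin [s] is.

    Quasilocality also comes from the finite range: each kernel mass depends
    on finitely many spins, so the kernel maps local functions to local
    functions, and being an average it does not increase uniform distances
    ([quasilocal_spec_local]). *)

(** * Total variation distance to a Dirac mass *)

Lemma mass_sum_neq (R : realType) (T : finType) (mu : fdist R T) (s : T) :
  \sum_(a | a != s) mu a = 1 - mu s.
Proof.
by apply/eqP; rewrite eq_sym subr_eq addrC -(mass_sum1 mu) [eqbLHS](bigD1 s).
Qed.

(** The defect [1 - mu s] at [s] equals the total mass off [s], so the two
    contributions to the L1 norm cancel the factor 1/2. *)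
Lemma d_TV_dirac (R : realType) (T : finType) (mu : fdist R T) (s : T) :
  d_TV mu (fdirac R s) = 1 - mu s.
Proof.
rewrite /d_TV (bigD1 s) //= {1}/dirac_mass eqxx -mass_sum_neq.
have -> : `|mu s - 1%:R| = \sum_(a | a != s) mu a.
  rewrite mass_sum_neq distrC ger0_norm // -mass_sum_neq.
  by apply: sumr_ge0 => a _; apply: mass_ge0.
rewrite [X in _ + X](_ : _ = \sum_(a | a != s) mu a).
  by lra.
apply: eq_bigr => a /negbTE as_.
by rewrite /= /dirac_mass as_ subr0 ger0_norm // mass_ge0.
Qed.

Lemma d_TV_triangle (R : realType) (T : finType) (mu nu rho : fdist R T) :
  d_TV mu nu <= d_TV mu rho + d_TV nu rho.
Proof.
rewrite /d_TV -mulrDr ler_wpM2l ?invr_ge0 // -big_split /=.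
by apply: ler_sum => a _; rewrite [X in _ <= _ + X]distrC ler_distD.
Qed.

Lemma eq_d_TV0 (R : realType) (T : finType) (mu nu : fdist R T) :
  mu =1 nu -> d_TV mu nu = 0.
Proof.
by move=> h; rewrite /d_TV big1 ?mulr0 // => a _; rewrite h subrr normr0.
Qed.

(** * Single-site laws and Dobrushin's condition for a specification *)

Section Specification.
Context {R : realType} {V : choiceType}.
Implicit Types (gamma : specification R V) (eta zeta : config V).

Lemma glue_eq (L : {fset V}) (omega : {ffun L -> spin}) eta zeta (i : V) :
  (i \notin L -> eta i = zeta i) -> glue omega eta i = glue omega zeta i.
Proof.
move=> h; have [iL|iL] := boolP (i \in L); last by rewrite !glue_out ?h.
by rewrite !(glue_in omega _ [` iL]%fset).
Qed.

Definition one_site (i : V) (a : spin) : {ffun [fset i]%fset -> spin} :=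
  [ffun=> a].

Lemma single_siteE gamma i eta a :
  single_site gamma i eta a = spec_kernel gamma [fset i]%fset eta (one_site i a).
Proof.
rewrite /= /image_mass (big_pred1 (one_site i a)) // => omega.
apply/eqP/eqP => [<-|->]; last by rewrite ffunE.
apply/ffunP => x; rewrite ffunE; congr (omega _); apply: val_inj => /=.
by have /fset1P := valP x.
Qed.

(** A nearest-neighbour interaction has at most [N] nonzero coefficients in
    each row, which turns a bound on the coefficients into one on the sums. *)
Lemma dobrushin_const_le gamma (G : graph V) (c : R) (N : nat) :
  locally_finite G -> (forall i, degree G i <= N)%N -> 0 <= c ->
  (forall i j, ~~ G i j -> (dobrushin_coeff gamma i j <= 0)%E) ->
  (forall i j, (dobrushin_coeff gamma i j <= c%:E)%E) ->
  (dobrushin_const gamma <= (c *+ N)%:E)%E.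
Proof.
move=> Gfin degN c0 far near; apply: ge_ereal_sup => _ [i _ <-].
apply: (@le_trans _ _ (\esum_(j in neighbours G i) c%:E)%E).
  rewrite [leRHS]esum_mkcond; apply: le_esum => j _.
  by case: ifPn => //; rewrite notin_setE => /negP; apply: far.
rewrite esum_fset; last 2 first.
- exact: Gfin.
- by move=> j _; rewrite lee_fin.
rewrite fsbig_finite; last exact: Gfin.
rewrite sumEFin lee_fin big_const_seq count_predT iter_addr_0.
by apply: (ler_wpMn2l c0); apply: degN.
Qed.

(** Unfolds the entourages of uniform convergence into epsilons. *)
Lemma uniform_cvgP (F : nat -> config V -> R) (f : config V -> R) :
  {uniform, F @ \oo --> f} <->
  forall e : R, 0 < e -> \forall n \near \oo, forall eta, `|f eta - F n eta| < e.
Proof.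
split=> [Ff e e0|Ff].
  apply: (Ff [set h | forall eta, `|f eta - h eta| < e]).
  apply/uniform_nbhs; exists [set xy : R * R | ball xy.1 e xy.2]; split.
    by rewrite -entourage_ballE; exists e.
  by move=> h /= fh eta; apply: fh.
move=> P /uniform_nbhs[E []]; rewrite -entourage_ballE => -[e /= e0 eE] EP.
apply: filterS (Ff _ e0) => n Fn; apply: EP => eta _.
exact: (eE (f eta, F n eta) (Fn eta)).
Qed.

(** When [F n] approximates [f], the averages of [F n] approximate those of
    [f] at least as well, and an average of a local function under local
    weights depends only on the finite union of the supports involved. *)
Lemma quasilocal_spec_local gamma :
  (forall (L : {fset V}) (omega : {ffun L -> spin}),
     local (fun eta => spec_kernel gamma L eta omega)) ->
  quasilocal_spec gamma.
Proof.
move=> loc L f [F [locF /uniform_cvgP Ff]].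
exists (fun n => expect (spec_kernel gamma) L (F n)); split.
  move=> n; have [D FD] := locF n; have [S gS] := choice (loc L).
  exists (D `|` \bigcup_(omega <- enum {ffun L -> spin}) S omega)%fset.
  move=> eta zeta h; apply: eq_bigr => omega _; congr (_ * _).
    apply: gS => i iS; apply: h => /=; rewrite inE; apply/orP; right.
    by apply/bigfcupP; exists omega; rewrite // mem_enum.
  by apply: FD => i iD; apply: glue_eq => _; apply: h; rewrite /= inE iD.
apply/uniform_cvgP => e e0; have e20 : 0 < e / 2 by rewrite divr_gt0.
apply: filterS (Ff _ e20) => n Fn eta.
apply: (@le_lt_trans _ _ (e / 2)); last by lra.
rewrite /expect -sumrB; apply: (le_trans (ler_norm_sum _ _ _)).
have -> : e / 2 = \sum_omega spec_kernel gamma L eta omega * (e / 2).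
  by rewrite -mulr_suml mass_sum1 mul1r.
apply: ler_sum => omega _; rewrite -mulrBr normrM ger0_norm ?mass_ge0 //.
by rewrite ler_wpM2l ?mass_ge0 // ltW.
Qed.

End Specification.

(** * The Widom-Rowlinson kernels *)

Section WidomRowlinson.
Context {R : realType} {V : choiceType} {G : graph V}.
Hypothesis Gfin : locally_finite G.
Variables (beta : R) (alpha : fdist R spin).

(** Finite range: the spins off the edges that touch [L] do not enter the
    Hamiltonian in [L], and those in [L] are overwritten. *)
Lemma wr_weight_eq (L : {fset V}) (eta zeta : config V) (omega : {ffun L -> spin}) :
  (forall k i, edges_touching G L k -> i \in k -> i \notin L -> eta i = zeta i) ->
  wr_weight G beta alpha eta omega = wr_weight G beta alpha zeta omega.
Proof.
move=> h; rewrite /wr_weight /wr_energy; congr (expR (_ * _) * _).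
apply: eq_fsbigr => k /set_mem kG.
rewrite (@repels_eq _ _ (glue omega zeta)) // => i ik.
by apply: glue_eq; apply: (h k).
Qed.

Lemma wr_kernel_eq (L : {fset V}) (eta zeta : config V) :
  (forall k i, edges_touching G L k -> i \in k -> i \notin L -> eta i = zeta i) ->
  wr_kernel G beta alpha L eta =1 wr_kernel G beta alpha L zeta.
Proof.
move=> h omega; rewrite /= /wr_mass (wr_weight_eq _ _ _ omega h); congr (_ / _).
by apply: eq_bigr => w _; apply: wr_weight_eq.
Qed.

Lemma widom_rowlinson_quasilocal :
  quasilocal_spec (widom_rowlinson beta alpha Gfin).
Proof.
apply: quasilocal_spec_local => L omega.
exists (\bigcup_(k <- fset_set (edges_touching G L)) k)%fset => eta zeta h.
apply: wr_kernel_eq => k i kG ik _; apply: h; apply/bigfcupP; exists k => //.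
by rewrite andbT in_fset_set ?mem_set //; apply: finite_edges_touching.
Qed.

(** The spin at [j] is read only if [j] is a neighbour of [i], and the case
    [j = i] is included because resampling overwrites the spin at [i]. *)
Lemma single_site_eq (i j : V) (eta zeta : config V) : ~~ G i j ->
  agree_on (~` [set j]) eta zeta ->
  single_site (widom_rowlinson beta alpha Gfin) i eta =1
  single_site (widom_rowlinson beta alpha Gfin) i zeta.
Proof.
move=> nGij h a; rewrite !single_siteE; apply: wr_kernel_eq.
move=> _ y [[u [v [Guv ->]]] [x]]; rewrite !inE.
move=> xuv xi yuv yi; apply: h => /= yj; subst y; move/negP: nGij; apply.
move/eqP: xi => xi; subst x.
case/orP: xuv => /eqP ?; case/orP: yuv => /eqP ?; subst; rewrite ?eqxx // in yi *.
by rewrite adj_sym.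
Qed.

(** Each edge that touches [i] is [{i, j}] for some neighbour [j]. *)
Lemma card_edges_touching1 (i : V) :
  (#|` fset_set (edges_touching G [fset i]%fset)| <= degree G i)%N.
Proof.
have sub : edges_touching G [fset i]%fset `<=`
    (fun j => [fset i; j]%fset) @` neighbours G i.
  move=> _ [[u [v [Guv ->]]] [x]]; rewrite !inE => xuv /eqP xi; subst x.
  case/orP: xuv => /eqP ->; first by exists v.
  by exists u; rewrite /neighbours /= 1?adj_sym // fsetUC.
move: sub; rewrite fset_set_sub; last 2 first.
- exact: finite_edges_touching.
- exact/finite_image/Gfin.
move=> /fsubset_leq_card/leq_trans; apply.
by rewrite fset_set_image; [exact: leq_imfset_card|exact: Gfin].
Qed.

Lemma wr_energy_le (i : V) (xi : config V) :
  0 <= wr_energy R G [fset i]%fset xi <= (degree G i)%:R.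
Proof.
rewrite /wr_energy fsbig_finite; last exact: finite_edges_touching.
apply/andP; split; first by apply: sumr_ge0.
apply: (@le_trans _ _ (#|` fset_set (edges_touching G [fset i]%fset)|)%:R).
  rewrite -sum1_size natr_sum; apply: ler_sum => k _.
  by rewrite ler_nat leq_b1.
by rewrite ler_nat card_edges_touching1.
Qed.

Lemma wr_weight1E (i : V) (eta : config V) (a : spin) :
  wr_weight G beta alpha eta (one_site i a) =
  expR (- beta * wr_energy R G [fset i]%fset (glue (one_site i a) eta)) * alpha a.
Proof.
rewrite /wr_weight; congr (_ * _).
under eq_bigr do rewrite ffunE.
by rewrite prodr_const -cardfE cardfs1 expr1.
Qed.

(** The key estimate: compare each weight of a spin [a != s] with the single
    term of [s] in the partition function. *)
Lemma single_site_dirac_le (i : V) (eta : config V) (s : spin) (N : nat) :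
  0 <= beta -> (degree G i <= N)%N -> 0 < alpha s ->
  d_TV (single_site (widom_rowlinson beta alpha Gfin) i eta) (fdirac R s) <=
  d_TV alpha (fdirac R s) / (expR (- beta * N%:R) * alpha s).
Proof.
move=> beta0 degN als; rewrite !d_TV_dirac -!mass_sum_neq mulr_suml.
apply: ler_sum => a _; rewrite single_siteE /= /wr_mass wr_weight1E.
have m0 : 0 < expR (- beta * N%:R) * alpha s by rewrite mulr_gt0 ?expR_gt0.
apply: ler_pM.
- by rewrite mulr_ge0 ?expR_ge0 ?mass_ge0.
- by rewrite invr_ge0 ltW ?wr_partition_gt0.
- rewrite ler_piMl ?mass_ge0 // -[leRHS]expR0 ler_expR mulNr oppr_le0.
  by rewrite mulr_ge0 //; case/andP: (wr_energy_le i (glue (one_site i a) eta)).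
rewrite lef_pV2 ?posrE ?wr_partition_gt0 //.
apply: (@le_trans _ _ (wr_weight G beta alpha eta (one_site i s))).
  rewrite wr_weight1E ler_wpM2r ?mass_ge0 // ler_expR !mulNr lerN2.
  rewrite ler_wpM2l //; case/andP: (wr_energy_le i (glue (one_site i s) eta)).
  by move=> _ /le_trans; apply; rewrite ler_nat.
rewrite /wr_partition (bigD1 (one_site i s)) //= lerDl.
by apply: sumr_ge0 => w _; apply: wr_weight_ge0.
Qed.

Lemma dobrushin_coeff_wr_nonadj (i j : V) : ~~ G i j ->
  (dobrushin_coeff (widom_rowlinson beta alpha Gfin) i j <= 0)%E.
Proof.
move=> nGij; apply: ge_ereal_sup => _ [eta [zeta [h ->]]].
by rewrite eq_d_TV0 //; apply: single_site_eq h.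
Qed.

End WidomRowlinson.

Lemma degree_bounded (R : realType) (V : choiceType) (G : graph V) :
  (max_degree R G < +oo)%E -> exists N, forall i, (degree G i <= N)%N.
Proof.
move=> Gdeg; have le_max i : ((degree G i)%:R%:E <= max_degree R G)%E.
  by apply: ereal_sup_ubound; exists i.
case E : (max_degree R G) Gdeg le_max => [r| |] // _ le_max; last first.
  by exists 0%N => i; have := le_max i; rewrite leNgt ltNyr.
exists (Num.truncn r).+1 => i; rewrite -(ler_nat R).
by apply: le_trans (ltW (truncnS_gt r)); rewrite -lee_fin.
Qed.

Theorem theorem2p8 (R : realType) (V : choiceType) (G : graph V)
  (Ginf : infinite_set [set: V]) (Gconn : connected_graph G)
  (Gfin : locally_finite G) (Gdeg : (max_degree R G < +oo)%E)
  (beta : R) (beta_gt0 : 0 < beta) :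
  exists2 eps : R, 0 < eps &
    forall alpha : fdist R spin, (\bigcup_(i : spin) tv_ball i eps) alpha ->
      dobrushin_condition (widom_rowlinson beta alpha Gfin).
Proof.
have [N degN] := @degree_bounded R V G Gdeg.
pose m := expR (- beta * N%:R).
have m0 : 0 < m by apply: expR_gt0.
have m1 : m <= 1 by rewrite -expR0 ler_expR mulNr oppr_le0 mulr_ge0 // ltW.
have N1 : 0 < N.+1%:R :> R by rewrite ltr0n.
(* The estimate on a single-site law costs a factor [1 / m], a factor 2 since
   only [alpha s >= 1/2] is known, and a factor 2 for the triangle inequality;
   the last factor 2 and [N.+1], nonzero even if [N] is not, leave row sums at
   most [N / (2 * N.+1)]. *)
exists (m / (8 * N.+1%:R)) => [|alpha [s _ als]].
  by rewrite divr_gt0 // mulr_gt0.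
split; last exact: widom_rowlinson_quasilocal.
pose c : R := 2^-1 / N.+1%:R.
have c0 : 0 <= c by rewrite divr_ge0 ?invr_ge0 ?ltW.
have eps_le : m / (8 * N.+1%:R) <= 2^-1.
  rewrite ler_pdivrMr ?mulr_gt0 //.
  have : 1 <= N.+1%:R :> R by rewrite ler1n.
  by lra.
have as2 : 2^-1 <= alpha s.
  by have := lt_le_trans als eps_le; rewrite d_TV_dirac; lra.
have as0 : 0 < alpha s by lra.
have near i eta : d_TV (single_site (widom_rowlinson beta alpha Gfin) i eta)
    (fdirac R s) <= c / 2.
  apply: le_trans (single_site_dirac_le Gfin beta alpha i eta s N (ltW beta_gt0) (degN i) as0) _.
  rewrite ler_pdivrMr ?mulr_gt0 ?expR_gt0 // -/m.
  apply: (le_trans (ltW als)).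
  have -> : m / (8 * N.+1%:R) = c / 2 * (m * 2^-1).
    by rewrite /c; move: N1; generalize (N.+1%:R : R) => K K0; field; rewrite gt_eqF.
  by rewrite !ler_wpM2l // ?divr_ge0 // ltW.
have coeff i j : (dobrushin_coeff (widom_rowlinson beta alpha Gfin) i j <= c%:E)%E.
  apply: ge_ereal_sup => _ [eta [zeta [_ ->]]]; rewrite lee_fin.
  apply: le_trans (d_TV_triangle _ _ _ _ (fdirac R s)) _.
  by have := near i eta; have := near i zeta; lra.
apply: le_lt_trans (dobrushin_const_le _ _ _ _ Gfin degN c0 _ coeff) _.
  by move=> i j; apply: dobrushin_coeff_wr_nonadj.
rewrite lte_fin -mulr_natr /c mulrAC ltr_pdivrMr // mul1r.
by rewrite -[N.+1]addn1 natrD; have := ler0n R N; lra.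
Qed.
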